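(* Let $X$ be a smooth projective surface over $\mathbb{C}$, let $f:X\to X$ be an automorphism of positive topological entropy, and let $E$ be the maximal $f$-invariant curve. If a point $x\in X$ is not $f$-periodic and does not lie on $E$, then the orbit $\{f^n(x)\mid n\in\mathbb{Z}\}$ is Zariski dense in $X$.
   Context: A point $x$ is $f$-periodic if $f^n(x)=x$ for some positive integer $n$. An irreducible curve $C$ is $f$-periodic if $f^n(C)=C$ for some positive integer $n$; there are only finitely many such curves, and $E:=\sum C$ is the (possibly empty) reduced sum of all $f$-periodic irreducible curves, called the maximal $f$-invariant curve. Positive topological entropy of $f$ means that the spectral radius of $f^*$ on $H^2(X,\mathbb{R})$ is $>1$ (Gromov, Yomdin). *)

(* Defs.v *)
From HB Require Import structures.
From mathcomp Require Import all_boot all_order all_algebra.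
From mathcomp Require Import all_classical all_reals all_analysis.
From mathcomp Require Import complex.
From mathcomp Require mpoly.
Import (canonicals, coercions) mpoly.
Import numFieldNormedType.Exports.
Import Order.TTheory GRing.Theory Num.Theory.
Set Implicit Arguments.
Unset Strict Implicit.
Unset Printing Implicit Defensive.
Local Open Scope classical_set_scope.
Local Open Scope ring_scope.
Local Open Scope quotient_scope.

Lemma continuous_row (T : topologicalType) (K : numFieldType) m (f : T -> 'rV[K]_m) :
  (forall j, continuous (fun t => f t ord0 j)) -> continuous f.
Proof.
move=> cf t A [P fP PA].
have PP (j : 'I_m) : \forall u \near t, P ord0 j (f u ord0 j).
  by apply: cf; exact: fP.
have : \forall u \near t, forall j : 'I_m, P ord0 j (f u ord0 j).
  exact: filter_forall.
by apply: filterS => u Pu; apply: PA => i j; rewrite ord1; exact: Pu.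
Qed.

Section Singular.
Variable R : realType.

Definition std_simplex k : set 'rV[R]_k.+1 :=
  [set t | (forall i, 0 <= t 0 i) /\ \sum_i t 0 i = 1].

(* The i-th face inclusion inserts 0 in position i of the barycentric coordinates. *)
Definition insert0 k (i : 'I_k.+2) (t : 'rV[R]_k.+1) : 'rV[R]_k.+2 :=
  \row_j oapp (t 0) 0 (unlift i j).

Lemma insert0_simplex k (i : 'I_k.+2) t :
  std_simplex t -> insert0 i t \in (@std_simplex k.+1).
Proof.
move=> [t0 t1]; rewrite inE; split=> [j|].
  by rewrite mxE; case: unlift => [l|] /=.
rewrite (bigD1_ord i) //= mxE unlift_none add0r -[RHS]t1.
by apply: eq_bigr => j _; rewrite mxE liftK.
Qed.

Definition face_map k (i : 'I_k.+2) (t : @std_simplex k) : @std_simplex k.+1 :=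
  exist _ (insert0 i (val t)) (insert0_simplex i (set_valP t)).

Lemma face_map_continuous k (i : 'I_k.+2) : continuous (face_map i).
Proof.
apply: continuous_comp_initial; apply: continuous_row => j.
rewrite (_ : (fun _ => _) =
  fun t : @std_simplex k => oapp ((set_val t) ord0) 0 (unlift i j)); last first.
  by apply/funext => t /=; rewrite mxE.
case: unlift => [l|] /= t; last exact: cst_continuous.
apply: (@continuous_comp _ _ _ set_val (fun v : 'rV_k.+1 => v ord0 l)).
  exact: initial_continuous.
exact: coord_continuous.
Qed.

HB.instance Definition _ k (i : 'I_k.+2) :=
  isContinuous.Build _ _ (face_map i) (@face_map_continuous k i).

Definition singular_simplex (T : topologicalType) k := continuousType (@std_simplex k) T.

Definition cochain (T : topologicalType) k : Type := singular_simplex T k -> R^o.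
HB.instance Definition _ T k := GRing.Lmodule.on (cochain T k).

Section Complex.
Variables (T : topologicalType) (k : nat).

Definition coboundary (c : cochain T k) : cochain T k.+1 := fun s =>
  \sum_(i < k.+2) (-1) ^+ i * c (s \o face_map i : continuousType _ _).

Lemma coboundary_linear : linear coboundary.
Proof.
move=> a b c; apply/funext => s.
change (coboundary (a *: b + c) s = a * coboundary b s + coboundary c s).
rewrite /coboundary mulr_sumr -big_split /=; apply: eq_bigr => i _.
by rewrite [(a *: b + c) _]/(a * b _ + c _) mulrDr mulrCA.
Qed.
HB.instance Definition _ :=
  GRing.isLinear.Build R (cochain T k) (cochain T k.+1) _ coboundary coboundary_linear.

Definition is_cocycle : {pred cochain T k} := [pred c | coboundary c == 0].

Lemma cocycle_submod : submod_closed is_cocycle.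
Proof.
split=> [|a b c]; first by apply/eqP; exact: linear0.
move=> /eqP b0 /eqP c0; apply/eqP.
by rewrite (coboundary_linear a b c) b0 c0 scaler0 addr0.
Qed.
HB.instance Definition _ :=
  GRing.isSubmodClosed.Build R (cochain T k) is_cocycle cocycle_submod.

Record cocycle := Cocycle { cocycle_val :> cochain T k; _ : is_cocycle cocycle_val }.
HB.instance Definition _ := [isSub for cocycle_val].
HB.instance Definition _ := [Choice of cocycle by <:].
HB.instance Definition _ := [SubChoice_isSubLmodule of cocycle by <:].
End Complex.

(* Coboundaries; there are none but 0 in degree 0. *)
Definition exact_cochain (T : topologicalType) k : set (cochain T k) :=
  match k with
  | 0 => [set 0]
  | k'.+1 => range (@coboundary T k')
  end.

Section Cohomology.
Variables (T : topologicalType) (k : nat).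

Definition is_coboundary : {pred cocycle T k} :=
  [pred z : cocycle T k | `[< exact_cochain (z : cochain T k) >]].

Lemma exact_cochainP a (x y : cochain T k) :
  exact_cochain x -> exact_cochain y -> exact_cochain (a *: x + y).
Proof.
case: k x y => [x y /= -> ->|k' x y /= [b _ <-] [c _ <-]].
  by rewrite scaler0 addr0.
by exists (a *: b + c) => //; rewrite linearP.
Qed.

Lemma exact_cochain0 : exact_cochain (0 : cochain T k).
Proof. by case: k => //= k'; exists 0 => //; rewrite linear0. Qed.

Lemma coboundary_submod : submod_closed is_coboundary.
Proof.
split=> [|a x y]; rewrite !inE.
  rewrite -[X in exact_cochain X]/(val (0 : cocycle T k)) raddf0.
  exact: exact_cochain0.
rewrite -[X in _ -> _ -> exact_cochain X]/(val (a *: x + y : cocycle T k)) linearP.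
exact: exact_cochainP.
Qed.
HB.instance Definition _ :=
  GRing.isSubmodClosed.Build R (cocycle T k) is_coboundary coboundary_submod.

Definition coboundaries : zmodClosed (cocycle T k) :=
  is_coboundary.

(* H^k(T, R): singular cocycles modulo coboundaries. *)
Definition cohomology : Type := Quotient.quot coboundaries.
HB.instance Definition _ := GRing.Zmodule.on cohomology.
HB.instance Definition _ := EqQuotient.on cohomology.

Definition cohomology_scale (a : R) (x : cohomology) : cohomology :=
  \pi_cohomology (a *: repr x).

Lemma pi_cohomologyP (x y : cocycle T k) :
  x - y \in coboundaries -> \pi_cohomology x = \pi_cohomology y.
Proof. by move=> xy; apply/eqP; rewrite -(@Quotient.idealrBE _ coboundaries). Qed.

Lemma pi_cohomologyD (x y : cocycle T k) :
  \pi_cohomology (x + y) = \pi_cohomology x + \pi_cohomology y.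
Proof. by rewrite [LHS](@Quotient.pi_add _ coboundaries). Qed.

Lemma repr_cohomologyP (x : cocycle T k) :
  repr (\pi_cohomology x) - x \in coboundaries.
Proof. by rewrite (@Quotient.idealrBE _ coboundaries) reprK. Qed.

Lemma pi_cohomologyZ a (x : cocycle T k) :
  cohomology_scale a (\pi_cohomology x) = \pi_cohomology (a *: x).
Proof.
by apply: pi_cohomologyP; rewrite -scalerBr rpredZ //; exact: repr_cohomologyP.
Qed.

Lemma cohomology_scaleA a b x :
  cohomology_scale a (cohomology_scale b x) = cohomology_scale (a * b) x.
Proof.
by rewrite -[x]reprK (pi_cohomologyZ b) (pi_cohomologyZ a)
  (pi_cohomologyZ (a * b)) scalerA.
Qed.
Lemma cohomology_scale1 : left_id 1 cohomology_scale.
Proof. by move=> x; rewrite -[x]reprK pi_cohomologyZ scale1r. Qed.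
Lemma cohomology_scaleDr : right_distributive cohomology_scale +%R.
Proof.
move=> a x y; rewrite -[x]reprK -[y]reprK -pi_cohomologyD !pi_cohomologyZ.
by rewrite scalerDr pi_cohomologyD.
Qed.
Lemma cohomology_scaleDl x : {morph cohomology_scale^~ x : a b / a + b}.
Proof.
move=> a b; rewrite -[x]reprK !pi_cohomologyZ.
by rewrite scalerDl pi_cohomologyD.
Qed.
HB.instance Definition _ := GRing.Zmodule_isLmodule.Build R cohomology
  cohomology_scaleA cohomology_scale1 cohomology_scaleDr cohomology_scaleDl.

End Cohomology.

Section Pullback.
Variables (T U : topologicalType) (g : continuousType T U).

Definition cochain_pullback k (c : cochain U k) : cochain T k :=
  fun s => c (g \o s : continuousType _ _).

Lemma pullback_coboundary k (c : cochain U k) :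
  coboundary (cochain_pullback c) = cochain_pullback (coboundary c).
Proof.
apply/funext => s; apply: eq_bigr => i _; congr (_ * c _).
exact/continuousEP.
Qed.

Lemma pullback_cocycle k (z : cocycle U k) :
  is_cocycle (cochain_pullback (z : cochain U k)).
Proof.
case: z => c /= /eqP c0.
by rewrite /is_cocycle /= pullback_coboundary c0.
Qed.

Definition cocycle_pullback k (z : cocycle U k) : cocycle T k :=
  Cocycle (pullback_cocycle z).

Definition cohomology_pullback k (x : cohomology U k) : cohomology T k :=
  \pi_(cohomology T k) (cocycle_pullback (repr x)).

Lemma exact_pullback k (c : cochain U k) :
  exact_cochain c -> exact_cochain (cochain_pullback c).
Proof.
case: k c => [c /= -> //|k c /= [b _ <-]].
by exists (cochain_pullback b) => //; rewrite pullback_coboundary.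
Qed.

Lemma cohomology_pullback_pi k (z : cocycle U k) :
  cohomology_pullback (\pi_(cohomology U k) z) =
  \pi_(cohomology T k) (cocycle_pullback z).
Proof.
apply: pi_cohomologyP; have := repr_cohomologyP z; rewrite !inE.
exact: exact_pullback.
Qed.

Lemma cohomology_pullback_linear k : linear (@cohomology_pullback k).
Proof.
move=> a x y; rewrite -[x]reprK -[y]reprK.
have e (V : topologicalType) (u v : cocycle V k) : a *: \pi_(cohomology V k) u + \pi_(cohomology V k) v =
    \pi_(cohomology V k) (a *: u + v).
  by rewrite pi_cohomologyD -pi_cohomologyZ.
rewrite e !cohomology_pullback_pi e; congr \pi.
exact: val_inj.
Qed.
HB.instance Definition _ k := GRing.isLinear.Build R (cohomology U k) (cohomology T k) _
  (@cohomology_pullback k) (@cohomology_pullback_linear k).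
End Pullback.

(* Eigenvalues of the complexification of the R-linear map phi: with z = a + ib,
   phi v + i phi w = z (v + i w). *)
Definition complex_eigenvalue (V : lmodType R) (phi : V -> V) : set R[i] :=
  [set z : R[i] | exists v w : V, [/\ (v, w) != 0,
     phi v = complex.Re z *: v - complex.Im z *: w & phi w = complex.Im z *: v + complex.Re z *: w]].

(* Largest modulus of a complex eigenvalue, for phi linear and V finite-dimensional. *)
Definition spectral_radius (V : lmodType R) (phi : V -> V) : \bar R :=
  ereal_sup [set (Normc.normc z)%:E | z in complex_eigenvalue phi].
End Singular.

(* Irreducibility and Krull dimension of a closed subset A; since A is closed,
   relatively closed subsets of A are the closed subsets contained in A. *)
Section KrullDim.
Variable T : topologicalType.
Definition irreducible_set (A : set T) : Prop := A !=set0 /\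
  forall B C : set T, closed B -> closed C ->
    A `<=` B `|` C -> A `<=` B \/ A `<=` C.

Definition irreducible_chain (A : set T) (m : nat) (Z : nat -> set T) : Prop :=
  (forall i, (i <= m)%N -> [/\ closed (Z i), irreducible_set (Z i) & Z i `<=` A]) /\
  (forall i, (i < m)%N -> Z i `<` Z i.+1).

Definition krull_dim (A : set T) (d : nat) : Prop :=
  (exists Z, irreducible_chain A d Z) /\ ~ (exists Z, irreducible_chain A d.+1 Z).
End KrullDim.

Section ProjectiveSpace.
Variables (K : fieldType) (n : nat).

Definition nonzero_vectors : set 'rV[K]_n.+1 := [set v | v != 0].

Definition same_line (u v : nonzero_vectors) : bool := (val u == val v)%MS.

Lemma same_line_refl : reflexive same_line.
Proof. by move=> u; exact/eqmxP. Qed.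
Lemma same_line_sym : symmetric same_line.
Proof. by move=> u v; rewrite /same_line andbC. Qed.
Lemma same_line_trans : transitive same_line.
Proof. by move=> v u w /eqmxP uv /eqmxP vw; apply/eqmxP/(eqmx_trans uv). Qed.

Canonical same_line_equiv :=
  EquivRel same_line same_line_refl same_line_sym same_line_trans.

Definition projspace : Type := {eq_quot same_line}.
HB.instance Definition _ := EqQuotient.on projspace.
HB.instance Definition _ := Choice.on projspace.

(* Homogeneous coordinates, for the representative chosen by the quotient;
   they are determined up to a nonzero scalar only, so that for homogeneous p
   the vanishing of [heval p x] depends on x alone, but its value does not. *)
Definition hcoord (x : projspace) : 'rV[K]_n.+1 := val (repr x).

Local Notation poly := (mpoly.mpoly n.+1 K).
Local Notation homog := (mpoly.ishomog mpoly.mdeg).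

Definition heval (p : poly) (x : projspace) : K := mpoly.meval (hcoord x ord0) p.

Definition zero_set (S : set poly) : set projspace :=
  [set x | forall p, S p -> heval p x = 0].

Definition algebraic_set (A : set projspace) : Prop :=
  exists2 S : set poly, (forall p, S p -> p \is homog) & A = zero_set S.

Definition zariski_open (U : set projspace) : Prop := algebraic_set (~` U).

Lemma zariski_openT : zariski_open setT.
Proof.
exists [set 1] => [_ ->|].
  by apply/mpoly.homogP; exists 0%N; exact: mpoly.dhomog1.
rewrite setCT; apply/seteqP; split => // x /(_ 1 erefl) /eqP.
by rewrite /heval mpoly.meval1 oner_eq0.
Qed.

Lemma zariski_openI (U V : set projspace) :
  zariski_open U -> zariski_open V -> zariski_open (U `&` V).
Proof.
move=> [S hS US] [T hT VT].
exists [set p | exists s t, [/\ S s, T t & p = s * t]].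
  move=> _ [s [t [/hS/mpoly.homogP [d sd] /hT/mpoly.homogP [e te] ->]]].
  by apply/mpoly.homogP; exists (d + e)%N; exact: mpoly.dhomogM.
rewrite setCI US VT; apply/seteqP; split => x.
  case=> zx _ [s [t [Ss Tt ->]]]; rewrite /heval mpoly.mevalM.
    by rewrite [X in X * _](zx s Ss) mul0r.
  by rewrite [X in _ * X](zx t Tt) mulr0.
move=> zx; have [|/existsNP [s /not_implyP[Ss /eqP sx]]] :=
  pselect (forall s, S s -> heval s x = 0); first by left.
right=> t Tt; have /eqP := zx (s * t) (ex_intro _ s (ex_intro _ t (And3 Ss Tt erefl))).
by rewrite /heval mpoly.mevalM mulf_eq0 (negPf sx) => /eqP.
Qed.

Lemma zariski_open_bigU (I : Type) (f : I -> set projspace) :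
  (forall i, zariski_open (f i)) -> zariski_open (\bigcup_i f i).
Proof.
move=> fo; exists [set p | p \is homog /\
    exists i, forall x, ~ f i x -> heval p x = 0]; first by move=> p [].
rewrite setC_bigcup; apply/seteqP; split => x /=.
  by move=> fx p [_ [j]]; apply; exact: fx.
move=> zx i _ /=; have [S hS fS] := fo i.
have : zero_set S x.
  move=> p Sp; apply: zx; split; first exact: hS.
  by exists i => y fy; have : zero_set S y by [rewrite -fS]; exact.
by rewrite -fS.
Qed.

(* The canonical topology of projspace is the Zariski topology, and a subset X
   of projspace, used as a type, carries the induced topology. The Euclidean
   topology over C is that of analytic_projspace below. *)
HB.instance Definition _ := isOpenTopological.Build projspace
  zariski_openT zariski_openI zariski_open_bigU.

(* Tangent space at x of the affine cone over X, cut out by the differentials of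
   the homogeneous ideal of X. Its dimension is one more than that of the Zariski
   tangent space of X at x; the condition in smooth_at is the Jacobian criterion. *)
Definition tangent_vector (X : set projspace) (x : projspace)
    (v : 'rV[K]_n.+1) : Prop :=
  forall p : poly, p \is homog -> (forall y, X y -> heval p y = 0) ->
    \sum_i heval (mpoly.mderiv i p) x * v ord0 i = 0.

Definition smooth_at (X : set projspace) (d : nat) (x : projspace) : Prop :=
  exists2 V : {vspace 'rV[K]_n.+1}, forall v, v \in V <-> tangent_vector X x v
    & \dim V = d.+1.

Definition smooth_projective_surface (X : set projspace) : Prop :=
  [/\ closed X, irreducible_set X, krull_dim X 2 & forall x, X x -> smooth_at X 2 x].
End ProjectiveSpace.
Arguments nonzero_vectors : clear implicits.

Definition regular_map (K : fieldType) m n (X : set (projspace K m))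
    (Y : set (projspace K n)) (f : X -> Y) : Prop :=
  forall x : X, exists (U : set X) (d : nat) (F : 'I_n.+1 -> mpoly.mpoly m.+1 K),
    [/\ open U, U x, forall i, F i \is mpoly.ishomog1 d mpoly.mdeg
      & forall y : X, U y ->
        (hcoord (val (f y)) == \row_i heval (F i) (val y))%MS].

Section Dynamics.
Variables (K : fieldType) (n : nat) (X : set (projspace K n)).

Record automorphism := Automorphism {
  aut_fun :> X -> X;
  aut_inv : X -> X;
  aut_regular : regular_map aut_fun;
  aut_inv_regular : regular_map aut_inv;
  aut_funK : cancel aut_fun aut_inv;
  aut_invK : cancel aut_inv aut_fun }.

Variable f : automorphism.

(* f^k for k : int; recall that Negz m is - m.+1. *)
Definition aut_iter (k : int) : X -> X :=
  match k with
  | Posz m => iter m f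
  | Negz m => iter m.+1 (aut_inv f)
  end.

Definition aut_orbit (x : X) : set X := [set aut_iter k x | k in [set: int]].

Definition periodic_point (x : X) : Prop :=
  exists2 m : nat, (0 < m)%N & iter m f x = x.

Definition irreducible_curve (C : set X) : Prop :=
  [/\ closed C, irreducible_set C & krull_dim C 1].

Definition periodic_curve (C : set X) : Prop :=
  irreducible_curve C /\ exists2 m : nat, (0 < m)%N & iter m f @` C = C.

(* The support of the reduced sum of all f-periodic irreducible curves. *)
Definition maximal_invariant_curve : set X :=
  \bigcup_(C in [set C | periodic_curve C]) C.
End Dynamics.

(* P^n with the quotient topology of K^(n+1) minus the origin. *)
Definition analytic_projspace (K : numFieldType) (n : nat) : Type :=
  quotient_topology (projspace K n).
HB.instance Definition _ (K : numFieldType) n :=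
  Topological.on (analytic_projspace K n).

Section Homog.
Variables (K : fieldType) (n : nat).
Lemma meval_homog k d (p : mpoly.mpoly k K) (c : K) (v : 'I_k -> K) :
  p \is mpoly.ishomog1 d mpoly.mdeg ->
  mpoly.meval (fun i => c * v i) p = c ^+ d * mpoly.meval v p.
Proof.
move=> /mpoly.dhomogP hp; rewrite !mpoly.mevalE mulr_sumr.
apply: eq_big_seq => m /hp /=; rewrite mpoly.mdegE => <-; rewrite mulrCA; congr (_ * _).
rewrite -prodrXr -big_split /=.
by apply: eq_bigr => i _; rewrite exprMn.
Qed.

Lemma hcoord_pi (v : nonzero_vectors K n) :
  exists2 c : K, c != 0 & hcoord (\pi_(projspace K n) v) = c *: val v.
Proof.
have : repr (\pi_(projspace K n) v) == v %[mod projspace K n] by rewrite reprK.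
rewrite -[_ == _]/(_ == _ %[mod {eq_quot @same_line K n}]) eqmodE.
move=> /andP[/sub_rVP [c e] _]; exists c; last exact: e.
have : val (repr (\pi_(projspace K n) v)) != 0 :=
  set_valP (repr (\pi_(projspace K n) v) : nonzero_vectors K n).
by rewrite e; apply: contra_neq => ->; rewrite scale0r.
Qed.

Lemma heval_pi d (p : mpoly.mpoly n.+1 K) (v : nonzero_vectors K n) :
  p \is mpoly.ishomog1 d mpoly.mdeg ->
  exists2 c : K, c != 0 &
    heval p (\pi_(projspace K n) v) = c * mpoly.meval (val v ord0) p.
Proof.
move=> hp; have [c c0 e] := hcoord_pi v.
exists (c ^+ d); first by rewrite expf_neq0.
rewrite /heval e -(meval_homog c (val v ord0) hp); apply: mpoly.meval_eq => i.
by rewrite mxE.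
Qed.
End Homog.

Section Cont.
Variable (K : numFieldType).

Lemma meval_continuous n (p : mpoly.mpoly n K) :
  continuous (fun v : 'rV[K]_n => mpoly.meval (v ord0) p).
Proof.
have cst (c : K) : continuous (fun _ : 'rV[K]_n => c).
  by move=> v; exact: cst_continuous.
have mul (f g : 'rV[K]_n -> K) : continuous f -> continuous g ->
    continuous (fun v => f v * g v).
  by move=> cf cg v; exact: (cvgM (cf v) (cg v)).
have add (f g : 'rV[K]_n -> K) : continuous f -> continuous g ->
    continuous (fun v => f v + g v).
  by move=> cf cg v; exact: (cvgD (cf v) (cg v)).
rewrite (_ : (fun _ => _) = fun v : 'rV[K]_n => \sum_(m <- mpoly.msupp p)
    mpoly.mcoeff m p * \prod_i v ord0 i ^+ mpoly.fun_of_multinom m i); last first.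
  by apply/funext => v; rewrite mpoly.mevalE.
elim: (mpoly.msupp p) => [|m s IH].
  rewrite (_ : (fun _ => _) = fun=> 0); first exact: cst.
  by apply/funext => v; rewrite big_nil.
under eq_fun do rewrite big_cons.
apply: (add) => //; apply: (mul); first exact: cst.
elim: (index_enum _) => [|i r IHr].
  by under eq_fun do rewrite big_nil; exact: cst.
under eq_fun do rewrite big_cons.
apply: (mul) => //.
elim: (mpoly.fun_of_multinom m i) => [|k IHk].
  by under eq_fun do rewrite expr0; exact: cst.
under eq_fun do rewrite exprS.
by apply: (mul) => //; exact: coord_continuous.
Qed.

Lemma open_nonzero : open [set x : K | x != 0].
Proof.
rewrite (_ : [set x | _] = ~` [set 0 : K]); last first.
  by apply/seteqP; split => x /= /eqP.
apply: closed_openC; apply: accessible_closed_set1.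
exact/hausdorff_accessible/norm_hausdorff.
Qed.

Lemma open_analyticE n (U : set (analytic_projspace K n)) :
  open U = open (\pi_(projspace K n) @^-1` U : set (nonzero_vectors K n)).
Proof. by []. Qed.

Lemma zariski_open_analytic n (U : set (projspace K n)) :
  open U -> open (U : set (analytic_projspace K n)).
Proof.
move=> [S hS US]; rewrite open_analyticE.
have -> : \pi_(projspace K n) @^-1` U =
    \bigcup_(p in S) [set v : nonzero_vectors K n | mpoly.meval (val v ord0) p != 0].
  apply/seteqP; split => [v Uv|v [p Sp /= pv]].
    have /existsNP[p /not_implyP[Sp /eqP pv]] : ~ zero_set S (\pi_(projspace K n) v).
      by rewrite -US; exact.
    exists p => //=; have /mpoly.homogP[d hd] := hS p Sp.
    have [c c0 e] := heval_pi v hd.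
    by move: pv; rewrite e mulf_eq0 negb_or => /andP[].
  apply: contrapT => nU; have zv : zero_set S (\pi_(projspace K n) v) by rewrite -US.
  have /mpoly.homogP[d hd] := hS p Sp.
  have [c c0 e] := heval_pi v hd.
  by move: (zv p Sp) => /eqP; rewrite e mulf_eq0 (negPf c0) (negPf pv).
apply: bigcup_open => p Sp.
have c : continuous (fun v : nonzero_vectors K n => mpoly.meval (set_val v ord0) p).
  have sc : continuous (set_val : nonzero_vectors K n -> 'rV[K]_n.+1).
    exact: initial_continuous.
  move=> v; exact: (continuous_comp (sc v) (@meval_continuous _ p _)).
have /continuousP/(_ [set x | x != 0]) := c; apply.
exact: open_nonzero.
Qed.
End Cont.

Definition analytic (K : numFieldType) n (X : set (projspace K n)) : Type :=
  set_type (X : set (analytic_projspace K n)).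
HB.instance Definition _ (K : numFieldType) n (X : set (projspace K n)) :=
  Topological.on (analytic X).

Section RegCont.
Variable (K : numFieldType).
Lemma open_nonzero_vectors n : open (nonzero_vectors K n).
Proof.
rewrite (_ : nonzero_vectors K n = ~` [set 0]); last first.
  by apply/seteqP; split => x /= /eqP.
apply: closed_openC; apply: accessible_closed_set1.
exact/hausdorff_accessible/norm_hausdorff.
Qed.

Lemma pi_eq_line n (u v : nonzero_vectors K n) :
  (val u == val v)%MS -> \pi_(projspace K n) u = \pi_(projspace K n) v.
Proof. by move=> uv; apply/eqmodP. Qed.

Lemma regular_continuous m n (X : set (projspace K m)) (Y : set (projspace K n))
    (f : X -> Y) :
  regular_map f -> continuous (f : analytic X -> analytic Y).
Proof.
move=> rf; apply: continuous_comp_initial => x A.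
rewrite nbhsE => - [V [oO Ofx] OA].
have [U [d [F [[W oW WU] Ux hF fF]]]] := rf x.
pose Phi (v : 'rV[K]_m.+1) : 'rV[K]_n.+1 := \row_i mpoly.meval (v ord0) (F i).
pose mk w (h : w \in nonzero_vectors K n) : nonzero_vectors K n := exist _ w h.
pose G := [set w : 'rV[K]_n.+1 | exists h : w \in nonzero_vectors K n,
  V (\pi_(projspace K n) (mk w h))].
have oG : open G.
  have [G0 oG0 G0E] := oO.
  rewrite (_ : G = G0 `&` nonzero_vectors K n).
    by apply: openI => //; exact: open_nonzero_vectors.
  apply/seteqP; split => w.
    move=> [h Ow]; split; last by move: (h); rewrite inE.
    have : (set_val @^-1` G0) (exist _ w h : nonzero_vectors K n) by rewrite G0E.
    by [].
  move=> [G0w w0]; have h : w \in nonzero_vectors K n by rewrite inE.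
  exists h; have : (set_val @^-1` G0) (exist _ w h : nonzero_vectors K n) by [].
  by rewrite G0E.
have satG (a : K) (w : 'rV[K]_n.+1) : a != 0 -> G (a *: w) <-> G w.
  move=> a0; split=> - [h Ow].
    have h' : w \in nonzero_vectors K n.
      by move: (h); rewrite !inE /nonzero_vectors /= scaler_eq0 negb_or => /andP[].
    exists h'; rewrite -(@pi_eq_line _ (mk _ h)) //=.
    exact/eqmxP/eqmx_scale.
  have h' : a *: w \in nonzero_vectors K n.
    by move: (h); rewrite !inE /nonzero_vectors /= scaler_eq0 negb_or a0.
  exists h'; rewrite (@pi_eq_line _ _ (mk _ h)) //=.
  exact/eqmxP/eqmx_scale.
have cPhi : continuous Phi.
  apply: continuous_row => j.
  under eq_fun do rewrite mxE.
  exact: meval_continuous.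
pose B := [set y : analytic_projspace K m | G (Phi (hcoord y))].
have oB : open B.
  rewrite open_analyticE.
  have -> : \pi_(projspace K m) @^-1` B =
      (Phi \o set_val) @^-1` G :> set (nonzero_vectors K m).
    have PhiE v : G (Phi (hcoord (\pi_(projspace K m) v))) <-> G (Phi (val v)).
      have [c c0 ->] := hcoord_pi v.
      rewrite -(satG (c ^+ d) (Phi (val v)) (expf_neq0 _ c0)).
      suff -> : Phi (c *: val v) = c ^+ d *: Phi (val v) by exact: iff_refl.
      apply/rowP => i; rewrite !mxE -(meval_homog _ _ (hF i)).
      by apply: mpoly.meval_eq => j; rewrite mxE.
    by apply/seteqP; split => v; [move/PhiE|move=> h; apply/PhiE].
  have cc : continuous (Phi \o set_val : nonzero_vectors K m -> 'rV[K]_n.+1).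
    move=> v; apply: continuous_comp; last exact: cPhi.
    exact: initial_continuous.
  by have /continuousP := cc; apply.
have oW' : open (W : set (analytic_projspace K m)) by exact: zariski_open_analytic.
have key (y : X) : U y -> exists h, val (f y) =
    \pi_(projspace K n) (mk (Phi (hcoord (val y))) h).
  move=> Uy; have := fF y Uy; rewrite -[\row_i _]/(Phi (hcoord (val y))) => e.
  have h : Phi (hcoord (val y)) \in nonzero_vectors K n.
    rewrite inE /=; have : hcoord (val (f y)) != 0 :=
      set_valP (repr (val (f y)) : nonzero_vectors K n).
    by move/eqmxP: e => e; rewrite /nonzero_vectors /= -!mxrank_eq0 e.
  exists h; rewrite -[LHS]reprK; exact: pi_eq_line.
have nB : nbhs x (set_val @^-1` (B `&` W) : set (analytic X)).
  apply: open_nbhs_nbhs; split; first by exists (B `&` W) => //; exact: openI.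
  split; last by move: Ux; rewrite -WU.
  by have [h e] := key x Ux; exists h; rewrite -e.
apply: filterS nB => y [By Wy]; apply: OA => /=.
have Uy : U y by rewrite -WU.
by have [h e] := key y Uy; case: By => h'; rewrite (bool_irrelevance h' h) -e.
Qed.
End RegCont.

Definition analytic_map (K : numFieldType) n (X : set (projspace K n))
    (f : automorphism X) : continuousType (analytic X) (analytic X) :=
  mkcts (regular_continuous (aut_regular f)).

(* Spectral radius of f^* on H^2(X, R) larger than 1 (Gromov, Yomdin). *)
Definition positive_entropy (R : realType) n (X : set (projspace R[i] n))
    (f : automorphism X) : Prop :=
  (1 < spectral_radius (@cohomology_pullback R _ _ (analytic_map f) 2))%E.

(* Main.v *)
(* The closure Z of the orbit is a closed set stable under f and its inverse; suppose
   it is not X. The Zariski topology being noetherian (Hilbert's basis theorem), Z has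
   finitely many maximal irreducible closed subsets, and f permutes them, so each is
   periodic. By dimension, one of those containing x is either a curve, which then lies
   in E, or reduced to x, which is then periodic. *)
Require Import Defs.
From mathcomp Require Import all_boot all_order all_algebra.
From mathcomp Require Import all_classical all_reals all_analysis.
From mathcomp Require Import complex.
From mathcomp Require mpoly.
Import (canonicals, coercions) mpoly.
Import Order.TTheory GRing.Theory.
Set Implicit Arguments.
Unset Strict Implicit.
Unset Printing Implicit Defensive.
Local Open Scope classical_set_scope.
Local Open Scope ring_scope.

(** * Dickson's lemma on exponent vectors *)

Section Dickson.
Local Open Scope nat_scope.

(** [a N] is an index where [u] is minimal among the indices from [N] on, and [h] iterates [a], each
    time starting just past the previous value. So [u (h k)] is minimal over a range that contains
    [h k.+1]. *)
Lemma nondecreasing_subseq (u : nat -> nat) :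
  exists2 h : nat -> nat, {homo h : i j / i < j} & {homo u \o h : i j / i <= j}.
Proof.
have /choice[a aP] N : exists a, N <= a /\ forall k, N <= k -> u a <= u k.
  have exN : exists v, `[< exists2 k, N <= k & u k = v >].
    by exists (u N); apply/asboolP; exists N.
  have [_ /asboolP[a Na <-] amin] := find_ex_minn exN.
  by exists a; split=> // k Nk; apply: amin; apply/asboolP; exists k.
pose h := fix h k := if k is k'.+1 then a (h k').+1 else a 0.
have hS k : h k < h k.+1 by have [] := aP (h k).+1.
exists h; first by apply: homo_ltn => //; exact: ltn_trans.
apply: homo_leq => // [|k]; first exact: leq_trans.
have [N hk] : exists N, h k = a N by case: k => [|k]; eexists.
rewrite /= -/(h k.+1) hk; have [Na] := aP N; apply.
by apply: leq_trans Na _; rewrite -hk ltnW // -/(h k.+1) hS.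
Qed.

(** The subsequence is refined one variable at a time, until all [n] exponents are nondecreasing
    along it. *)
Lemma dickson n (m : nat -> mpoly.multinom n) :
  exists i j, i < j /\ mpoly.lem (m i) (m j).
Proof.
suff [h hlt hm] : exists2 h : nat -> nat, {homo h : i j / i < j} &
    forall l : 'I_n, {homo (fun k => mpoly.fun_of_multinom (m (h k)) l) : i j / i <= j}.
  exists (h 0), (h 1); split; first exact: hlt.
  by apply/mpoly.mnm_lepP => l; exact: hm.
suff /(_ n) [h hlt hm] : forall r, exists2 h : nat -> nat, {homo h : i j / i < j} &
    forall l : 'I_n, l < r ->
      {homo (fun k => mpoly.fun_of_multinom (m (h k)) l) : i j / i <= j}.
  by exists h => // l; exact: hm.
elim=> [|r [h hlt hm]]; first by exists id.
have [rn|nr] := ltnP r n; last first.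
  by exists h => // l _; apply: hm; exact: leq_trans (ltn_ord l) nr.
have [g glt gm] := nondecreasing_subseq
  (fun k => mpoly.fun_of_multinom (m (h k)) (Ordinal rn)).
exists (h \o g) => [i j ij|l]; first exact/hlt/glt.
rewrite ltnS leq_eqVlt => /predU1P[lr|/hm hl] i j ij /=.
  by rewrite (_ : l = Ordinal rn); [exact: gm|exact: val_inj].
by apply: hl; move: ij; rewrite leq_eqVlt => /predU1P[->//|/glt/ltnW].
Qed.

End Dickson.

(** * Hilbert's basis theorem, by reduction of leading terms *)

Section Hilbert.
Variables (K : fieldType) (n : nat).
Local Notation poly := (mpoly.mpoly n K).

Lemma ex_minimal_mlead (P : set poly) : P !=set0 ->
  exists2 p, P p & forall q, P q -> ~ (mpoly.mlead q < mpoly.mlead p)%O.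
Proof.
move=> [p Pp]; apply: contrapT => nP; move: p Pp.
apply: mpoly.mleadrect => p IH Pp; apply: nP; exists p => // q Pq qp.
exact: IH Pq.
Qed.

(** One step of polynomial division: [r] is the single term for which [r * p] has the same leading
    term as [q]. *)
Lemma mlead_cancel (p q : poly) :
    p != 0 -> q != 0 -> mpoly.lem (mpoly.mlead p) (mpoly.mlead q) ->
  exists r, q - r * p = 0 \/ (mpoly.mlead (q - r * p) < mpoly.mlead q)%O.
Proof.
move=> p0 q0 pq.
have lp0 : mpoly.mcoeff (mpoly.mlead p) p != 0 by rewrite mpoly.mleadc_eq0.
have lq0 : mpoly.mcoeff (mpoly.mlead q) q != 0 by rewrite mpoly.mleadc_eq0.
pose m := mpoly.mnm_sub (mpoly.mlead q) (mpoly.mlead p).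
pose c := mpoly.mcoeff (mpoly.mlead q) q / mpoly.mcoeff (mpoly.mlead p) p.
have c0 : c != 0 by rewrite mulf_neq0 ?invr_eq0.
pose r : poly := c *: mpoly.mpolyX K m.
have r0 : mpoly.mcoeff m r = c.
  by rewrite /r mpoly.mcoeffZ mpoly.mcoeffX eqxx mulr1.
have lr : mpoly.mlead r = m by rewrite mpoly.mleadZ // mpoly.mleadXm.
have rN0 : r != 0 by rewrite -mpoly.mleadc_eq0 lr r0.
have lrp : mpoly.mlead (r * p) = mpoly.mlead q.
  by rewrite mpoly.mleadM // lr mpoly.submK.
exists r; have [->|d0] := eqVneq (q - r * p) 0; first by left.
right; rewrite lt_neqAle; apply/andP; split.
  (* If the leading monomial were unchanged, the leading coefficient of the difference would be 0 by
     the choice of [c], and the difference itself would vanish. *)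
  apply: contra_neq d0 => ld; apply/eqP; rewrite -mpoly.mleadc_eq0 ld.
  rewrite mpoly.mcoeffB -{2}lrp lrp -{2}(mpoly.submK pq) -/m -{1}lr.
  by rewrite mpoly.mleadcM lr r0 divfK // subrr.
by have := mpoly.mleadB_le q (r * p); rewrite lrp joinxx.
Qed.

(** Containing 0 and being closed under [q - r * p] together amount to being an ideal; this form is
    the one that a reduction step uses. *)
Lemma ideal_chain_stationary (I : nat -> set poly) :
    (forall k, I k 0) ->
    (forall k r p q, I k p -> I k q -> I k (q - r * p)) ->
    (forall k, I k `<=` I k.+1) ->
  exists k, I k.+1 `<=` I k.
Proof.
move=> I0 Iideal Imono; apply: contrapT => nI.
(* p k has minimal leading monomial among the polynomials entering at step k.+1;
   by Dickson's lemma some p i can be used to reduce a later p j. *)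
have /choice[p pP] k : exists p, (I k.+1 `\` I k) p /\
    forall q, (I k.+1 `\` I k) q -> ~ (mpoly.mlead q < mpoly.mlead p)%O.
  have [|p ? ?] := @ex_minimal_mlead (I k.+1 `\` I k); last by exists p.
  by apply/set0P/eqP; rewrite setD_eq0 => Ik; apply: nI; exists k.
have Ile i j : (i <= j)%N -> I i `<=` I j.
  by move=> /subnK <-; elim: (j - i)%N => // d IH q /IH; exact: Imono.
have p0 k : p k != 0.
  by have [[_ nIk] _] := pP k; apply/eqP => pk0; apply: nIk; rewrite pk0.
have [i [j [ij lpij]]] := dickson (fun k => mpoly.mlead (p k)).
have [[Ipi _] _] := pP i; have [[Ipj nIpj] minj] := pP j.
have [r rP] := mlead_cancel (p0 i) (p0 j) lpij.
have Irpi : I j (- r * p i).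
  by rewrite mulNr -sub0r; apply: Iideal => //; exact: (Ile i.+1) Ipi.
(* Adding [r * p i] back to a remainder in [I j] would put [p j] there. So the remainder is nonzero,
   and a smaller leading monomial contradicts the choice of [p j]. *)
have nId : ~ I j (p j - r * p i).
  move=> Id; apply: nIpj.
  suff -> : p j = (p j - r * p i) - 1 * (- r * p i) by exact: Iideal.
  by rewrite mul1r mulNr opprK subrK.
case: rP => [d0|/minj]; first by case: nId; rewrite d0.
by apply; split=> //; apply: Iideal => //; exact: (Ile i.+1 _ (leqW ij)) Ipi.
Qed.
End Hilbert.

(** * Noetherian spaces and their irreducible subsets *)

(** One stationary step in every chain already forbids infinite strictly decreasing chains, so this
    is equivalent to the descending chain condition. *)
Definition noetherian_space (T : topologicalType) :=
  forall Z : nat -> set T, (forall k, closed (Z k)) ->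
    (forall k, Z k.+1 `<=` Z k) -> exists k, Z k `<=` Z k.+1.

Section Noetherian.
Variable T : topologicalType.
Hypothesis noethT : noetherian_space T.

(** Otherwise every counterexample contains a strictly smaller one, and choice strings them into a
    chain without stationary step. *)
Lemma noetherian_ind (P : set T -> Prop) :
    (forall Z, closed Z -> (forall Y, closed Y -> Y `<` Z -> P Y) -> P Z) ->
  forall Z, closed Z -> P Z.
Proof.
move=> IH Z0 cZ0; apply: contrapT => nP0.
pose S := {Z : set T | closed Z /\ ~ P Z}.
have /choice[s sP] (Z : S) : exists Y : S, sval Y `<` sval Z.
  case: Z => Z [cZ nPZ] /=; apply: contrapT => nY; apply: nPZ; apply: IH => // Y cY YZ.
  by apply: contrapT => nPY; apply: nY; exists (exist _ Y (conj cY nPY)).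
pose Z k := sval (iter k s (exist _ Z0 (conj cZ0 nP0))).
have [k|k|k] := noethT (Z := Z).
- by rewrite /Z; case: (iter k s _) => ? [].
- by have [] := sP (iter k s (exist _ Z0 (conj cZ0 nP0))).
- by have [] := sP (iter k s (exist _ Z0 (conj cZ0 nP0))).
Qed.

(** Noetherian induction: a closed set neither empty nor irreducible is covered by two proper closed
    parts, whose lists are concatenated. The list may contain more than the irreducible
    components. *)
Lemma irreducible_decomposition (Z : set T) : closed Z ->
  exists2 s : seq (set T),
    forall B, B \in s -> [/\ closed B, irreducible_set B & B `<=` Z]
  & forall A, irreducible_set A -> A `<=` Z -> exists2 B, B \in s & A `<=` B.
Proof.
elim/noetherian_ind => {}Z cZ IH.
have [irrZ|nirrZ] := pselect (irreducible_set Z).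
  exists [:: Z] => [B|A _ AZ].
    by rewrite mem_seq1 => /eqP ->; split.
  by exists Z; rewrite ?mem_head.
have [->|/set0P Z0] := eqVneq Z set0.
  by exists [::] => // A [/set0P/eqP A0 _]; rewrite subset0.
have [B [C [cB cC ZBC [nZB nZC]]]] : exists B C, [/\ closed B, closed C, Z `<=` B `|` C
    & ~ Z `<=` B /\ ~ Z `<=` C].
  apply: contrapT => nBC; apply: nirrZ; split=> // B C cB cC ZBC.
  by apply: contrapT => /not_orP[nZB nZC]; apply: nBC; exists B, C.
have sub D : ~ Z `<=` D -> Z `&` D `<` Z.
  by move=> nZD; split=> [|ZZD]; [exact: subIsetl|apply: nZD => z /ZZD[]].
have [s sP sC] := IH _ (closedI cZ cB) (sub B nZB).
have [t tP tC] := IH _ (closedI cZ cC) (sub C nZC).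
exists (s ++ t) => [D|A irrA AZ].
  by rewrite mem_cat => /orP[/sP|/tP] [? ?]; rewrite subsetI => -[].
have [AB|AC] : A `<=` B \/ A `<=` C by apply: irrA.2 => //; exact: subset_trans ZBC.
- have [|D Ds AD] := sC A irrA; first by rewrite subsetI.
  by exists D => //; rewrite mem_cat Ds.
- have [|D Dt AD] := tC A irrA; first by rewrite subsetI.
  by exists D => //; rewrite mem_cat Dt orbT.
Qed.
End Noetherian.

(** * Images under homeomorphisms and periodicity of maximal irreducible subsets *)

Section Continuous.
Context {S T : topologicalType}.

Lemma irreducible_set_image (f : S -> T) (A : set S) :
  continuous f -> irreducible_set A -> irreducible_set (f @` A).
Proof.
move=> cf [[a Aa] irrA]; split; first by exists (f a), a.
move=> B C cB cC fABC.
have cpre := proj1 (continuous_closedP f) cf.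
have [|AB|AC] := irrA _ _ (cpre B cB) (cpre C cC).
- by move=> x Ax; apply: fABC; exists x.
- by left=> _ [x Ax <-]; exact: AB.
- by right=> _ [x Ax <-]; exact: AC.
Qed.

Lemma can_closed_image (f : S -> T) (g : T -> S) (A : set S) :
  cancel f g -> cancel g f -> continuous g -> closed A -> closed (f @` A).
Proof.
move=> fK gK cg cA.
suff -> : f @` A = g @^-1` A by exact: (proj1 (continuous_closedP g)).
by apply/seteqP; split=> [_ [x Ax <-]|y Agy] /=; [rewrite fK|exists (g y)].
Qed.
End Continuous.

Section Dynamics.
Variables (T : topologicalType) (g h : T -> T).
Hypotheses (noethT : noetherian_space T) (cg : continuous g) (ch : continuous h).
Hypotheses (gK : cancel g h) (hK : cancel h g).

(** Every image g^k(M) belongs to the finite list [s], so two of them coincide; applying a power of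
    [h] to both leaves a period. *)
Lemma maximal_irreducible_periodic (Z M : set T) :
    closed Z -> g @` Z `<=` Z -> h @` Z `<=` Z ->
    irreducible_set M -> M `<=` Z ->
    (forall A, closed A -> irreducible_set A -> A `<=` Z -> M `<=` A -> A = M) ->
  exists2 m, (0 < m)%N & iter m g @` M = M.
Proof.
move=> cZ gZ hZ irrM MZ maxM.
have [s sP sC] := irreducible_decomposition noethT cZ.
have iK k : cancel (iter k g) (iter k h).
  by elim: k => // k IH y; rewrite iterSr iterS [h _]gK IH.
have iK' k : cancel (iter k h) (iter k g).
  by elim: k => // k IH y; rewrite iterSr iterS [g _]hK IH.
have ci (u : T -> T) k : continuous u -> continuous (iter k u).
  move=> cu; elim: k => [|k IH] y; first exact: cvg_id.
  exact: (continuous_comp (IH y) (cu _)).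
have iZ (u : T -> T) k : u @` Z `<=` Z -> iter k u @` Z `<=` Z.
  move=> uZ _ [y Zy <-]; elim: k => // k IH.
  by apply: uZ; exists (iter k u y).
have gMs k : iter k g @` M \in s.
  have irrk := irreducible_set_image (ci g k cg) irrM.
  have sub : iter k g @` M `<=` Z.
    by move=> _ [y /MZ Zy <-]; apply: (iZ _ k gZ); exists y.
  have [B Bs MB] := sC _ irrk sub; have [cB irrB BZ] := sP B Bs.
  (* The member [B] containing g^k(M) is carried by h^k to a closed irreducible subset of [Z]
     containing [M], which is [M] by maximality. *)
  suff <- : B = iter k g @` M by [].
  rewrite -[in RHS](maxM (iter k h @` B)).
  - by rewrite image_comp (_ : _ \o _ = id) ?image_id //; apply/funext; exact: iK'.
  - exact: (can_closed_image (iK' k) (iK k) (ci _ k cg)).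
  - exact: irreducible_set_image (ci h k ch) irrB.
  - by move=> _ [y /BZ Zy <-]; apply: (iZ _ k hZ); exists y.
  - by move=> y My; exists (iter k g y); [apply: MB; exists y|exact: iK].
(* One image more than [s] has entries, which forces a repetition. *)
pose t := [seq iter k g @` M | k <- iota 0 (size s).+1].
have /(uniqPn set0)[i [j [ij]]] : ~~ uniq t.
  apply/negP => tU.
  have /(uniq_leq_size tU) : {subset t <= s} by move=> _ /mapP[k _ ->].
  by rewrite size_map size_iota ltnn.
rewrite size_map size_iota => js.
rewrite !(nth_map 0%N) ?size_iota ?(ltn_trans ij js) //.
rewrite !nth_iota ?(ltn_trans ij js) // !add0n => eij.
exists (j - i)%N; first by rewrite subn_gt0.
have imK (A : set T) : iter i h @` (iter i g @` A) = A.
  by rewrite image_comp (_ : _ \o _ = id) ?image_id //; apply/funext; exact: iK.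
rewrite -[RHS]imK eij -[LHS]imK; congr (_ @` _).
rewrite image_comp; congr (_ @` _); apply/funext => y /=.
by rewrite -iterD subnKC // ltnW.
Qed.
End Dynamics.

(** * The Zariski topology: chain condition, closed points, continuity of regular maps *)

Lemma comp_mpoly_homog (K : fieldType) m n d e (F : n.-tuple (mpoly.mpoly m K))
    (p : mpoly.mpoly n K) :
    (forall i, tnth F i \is mpoly.ishomog1 d mpoly.mdeg) ->
    p \is mpoly.ishomog1 e mpoly.mdeg ->
  mpoly.comp_mpoly F p \is mpoly.ishomog1 (d * e) mpoly.mdeg.
Proof.
move=> hF /mpoly.dhomogP hp; rewrite mpoly.comp_mpolyE big_seq.
apply: rpred_sum => a /hp /= ae; apply: mpoly.dhomogZ.
rewrite -ae mpoly.mdegE big_distrr /=.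
elim/big_rec2: _ => [|i q k _ hk]; first exact: mpoly.dhomog1.
by apply: mpoly.dhomogM => //; exact: mpoly.dhomogMn.
Qed.

Lemma set_val_continuous (T : topologicalType) (A : set T) :
  continuous (fun y : A => val y).
Proof. exact: initial_continuous. Qed.

Lemma closed_subspaceE (T : topologicalType) (A : set T) (Z : set A) : closed Z ->
  exists2 B : set T, closed B & Z = (fun y : A => val y) @^-1` B.
Proof.
move=> /closed_openC[U oU UZ]; exists (~` U); first exact: open_closedC.
by rewrite preimage_setC -[LHS]setCK -UZ.
Qed.

Section ZariskiSubspace.
Variables (K : fieldType) (n : nat).
Local Notation poly := (mpoly.mpoly n.+1 K).

Lemma zariski_closedP (A : set (projspace K n)) : closed A <-> algebraic_set A.
Proof.
split=> [/closed_openC|aA]; first by rewrite -[X in _ -> algebraic_set X]setCK.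
by rewrite -[A]setCK; apply: open_closedC; rewrite /open /= /zariski_open setCK.
Qed.

(** [I k] takes all polynomials, homogeneous or not, that vanish at the chosen coordinates of the
    points of [Z k]; as these coordinates are fixed, it is an ideal. Once [I k.+1] is inside [I k],
    the equations of [Z k.+1] hold on [Z k]. *)
Lemma zariski_noetherian (X : set (projspace K n)) : noetherian_space X.
Proof.
move=> Z cZ Zdec.
pose I k : set poly := [set p | forall y : X, Z k y -> heval p (val y) = 0].
have [||k p IkS|k Ik] := ideal_chain_stationary (I := I).
- by move=> k y _; rewrite /heval mpoly.meval0.
- move=> k r p q Ip Iq y Zy.
  rewrite /heval mpoly.mevalB mpoly.mevalM [X in _ - _ * X]Ip // [X in X - _]Iq //.
  by rewrite mulr0 subr0.
- by move=> y /Zdec; exact: IkS.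
have [B /zariski_closedP[S _ BS] ZB] := closed_subspaceE (cZ k.+1).
exists k => y Zy; rewrite ZB BS => p Sp; apply: Ik Zy => z.
by rewrite ZB BS => /(_ p Sp).
Qed.

Lemma hcoord_neq0 (x : projspace K n) : hcoord x != 0.
Proof. exact: (set_valP (repr x : nonzero_vectors K n)). Qed.

Lemma hcoord_inj (x y : projspace K n) : (hcoord x == hcoord y)%MS -> x = y.
Proof.
by move=> xy; rewrite -[x]reprK -[y]reprK; apply/eqmodP.
Qed.

(** The point is cut out by the 2 by 2 minors of the matrix whose rows are its coordinates [a] and
    the variables. *)
Lemma zariski_closed1 (x : projspace K n) : closed [set x].
Proof.
apply/zariski_closedP; pose a := hcoord x ord0.
pose minor (ij : 'I_n.+1 * 'I_n.+1) : poly :=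
  a ij.1 *: mpoly.mpolyX K (mpoly.mnm1 ij.2) -
  a ij.2 *: mpoly.mpolyX K (mpoly.mnm1 ij.1).
have minorE ij y : heval (minor ij) y =
    a ij.1 * hcoord y ord0 ij.2 - a ij.2 * hcoord y ord0 ij.1.
  by rewrite /heval mpoly.mevalB !mpoly.mevalZ !mpoly.mevalXU.
exists (range minor).
  move=> _ [ij _ <-]; apply/mpoly.homogP; exists 1%N.
  by apply: rpredB; apply: mpoly.dhomogZ; rewrite mpoly.dhomogX /= mpoly.mdeg1.
apply/seteqP; split=> [_ -> _ [ij _ <-]|y yP]; first by rewrite minorE mulrC subrr.
have [i ai0] : exists i, a i != 0.
  apply: contrapT => na; have /eqP := hcoord_neq0 x; apply.
  apply/rowP => i; rewrite mxE; apply/eqP; apply: contrapT => /negP ai.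
  by apply: na; exists i.
have yx : hcoord y = (hcoord y ord0 i / a i) *: hcoord x.
  apply/rowP => j; rewrite mxE -/(a j).
  have := yP _ (ex_intro2 _ _ (i, j) I erefl); rewrite minorE /= => /eqP.
  rewrite subr_eq0 => /eqP e; apply: (mulfI ai0).
  by rewrite e mulrA [a i * (_ / _)]mulrC divfK // mulrC.
apply: hcoord_inj; apply/eqmxP; rewrite yx; apply: eqmx_scale.
by have := hcoord_neq0 y; rewrite {1}yx scaler_eq0 negb_or => /andP[].
Qed.

Lemma zariski_subspace_closed1 (X : set (projspace K n)) (x : X) : closed [set x].
Proof.
suff -> : [set x] = (fun y : X => val y) @^-1` [set val x].
  by apply: (proj1 (continuous_closedP _) (@set_val_continuous _ X));
    exact: zariski_closed1.
by apply/seteqP; split=> [_ -> //|y /val_inj].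
Qed.
End ZariskiSubspace.

(** Substituting the local formulas [F] into an equation [p] of the complement of [W] that is
    nonzero at [f x] gives a homogeneous [q]; the part of [U] where [q] is nonzero is a
    neighbourhood of [x] sent into [W]. *)
Lemma regular_map_continuous (K : fieldType) m n (X : set (projspace K m))
    (Y : set (projspace K n)) (f : X -> Y) :
  regular_map f -> continuous f.
Proof.
move=> rf; apply/continuousP => A [W oW <-]; rewrite openE => x Wfx.
have [S hS WS] : algebraic_set (~` W).
  by apply/zariski_closedP; exact: open_closedC.
have [U [d [F [oU Ux hF fF]]]] := rf x.
have /existsNP[p /not_implyP[Sp pfx]] : ~ zero_set S (val (f x)) by rewrite -WS; exact.
have /mpoly.homogP[e hp] := hS p Sp.
pose q := mpoly.comp_mpoly [tuple F i | i < n.+1] p.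
have hq : q \is mpoly.ishomog1 (d * e) mpoly.mdeg.
  by apply: comp_mpoly_homog hp => i; rewrite tnth_mktuple.
have pq (y : X) : U y -> heval p (val (f y)) = 0 <-> heval q (val y) = 0.
  move=> /fF/andP[/sub_rVP[c fy] _].
  have c0 : c != 0.
    by have := hcoord_neq0 (val (f y)); rewrite fy scaler_eq0 negb_or => /andP[].
  (* The coordinates of [f y] agree with the values of [F] only up to the factor [c]. *)
  have -> : heval p (val (f y)) = c ^+ e * heval q (val y).
    rewrite /heval mpoly.comp_mpoly_meval -(meval_homog _ _ hp).
    by apply: mpoly.meval_eq => i; rewrite fy !mxE tnth_mktuple.
  split=> [/eqP|->]; last by rewrite mulr0.
  by rewrite mulf_eq0 expf_eq0 (negPf c0) andbF => /eqP.
pose V : set X := (fun y : X => val y) @^-1` (~` zero_set [set q]).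
have oV : open V.
  exists (~` zero_set [set q]) => //.
  apply: closed_openC; apply/zariski_closedP; exists [set q] => // _ ->.
  by apply/mpoly.homogP; exists (d * e)%N.
apply: (@filterS _ _ _ (U `&` V)) => [y [Uy Vy]|].
  apply: contrapT => nW; apply: Vy => _ ->; apply/(pq y Uy).
  by have : (~` W) (val (f y)) by []; rewrite WS; exact.
apply: open_nbhs_nbhs; split; first exact: openI.
by split=> // /(_ q erefl)/(pq x Ux).
Qed.

(** * Dimension counts on a surface *)

(** The dimension of [X] is measured in the ambient [T], chains in [C] in the subspace [X]. The
    chain is therefore pushed forward, staying closed because [X] is closed, before [X] is put on
    top. *)
Lemma irreducible_chain_extend (T : topologicalType) (X : set T) (C : set X) m Z :
    closed X -> irreducible_set X -> C `<` setT -> irreducible_chain C m Z ->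
  irreducible_chain X m.+1
    (fun i => if (i <= m)%N then (fun y : X => val y) @` Z i else X).
Proof.
move=> cX irrX [_ nC] [Zirr Zlt]; split=> [i _|i iSm]; last first.
  have [->|im] : i = m \/ (i < m)%N by apply/predU1P; rewrite -leq_eqVlt.
    rewrite leqnn ltnn; have [_ _ ZC] := Zirr m (leqnn m).
    split=> [_ [y _ <-]|sub]; first exact: set_valP.
    apply: nC => y _; apply: ZC; have [|z Zz /val_inj <- //] := sub (val y).
    exact: set_valP.
  rewrite im (ltnW im); have [sub nsub] := Zlt i im.
  split=> [_ [y Zy <-]|sub']; first by exists y => //; exact: sub.
  apply: nsub => y Zy; have [|z Zz /val_inj <- //] := sub' (val y).
  by exists y.
case: ifP => [im|_]; last by split.
have [cZ irrZ ZC] := Zirr i im; split.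
- have [B cB ZB] := closed_subspaceE cZ.
  suff -> : (fun y : X => val y) @` Z i = B `&` X by exact: closedI.
  apply/seteqP; split=> [_ [y + <-]|y [By Xy]].
    by rewrite ZB => By; split=> //; exact: set_valP.
  by exists (exist _ y (mem_set Xy)) => //; rewrite ZB.
- by apply: irreducible_set_image irrZ; exact: set_val_continuous.
- by move=> _ [y _ <-]; exact: set_valP.
Qed.

Lemma irreducible_set1 (T : topologicalType) (x : T) : irreducible_set [set x].
Proof.
split; first by exists x.
by move=> B C _ _ /(_ x erefl)[Bx|Cx]; [left|right] => _ ->.
Qed.

Section Surface.
Variables (K : fieldType) (n : nat) (X : set (projspace K n)).
Hypotheses (cX : closed X) (irrX : irreducible_set X) (dimX : krull_dim X 2).

(** A longer chain, cut off at index 2 and topped by [X], would have length 3 in a space of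
    dimension 2. *)
Lemma proper_chain_length (C : set X) m Z :
  C `<` setT -> irreducible_chain C m Z -> (m < 2)%N.
Proof.
move=> CT CZ; rewrite ltnNge; apply/negP => m2; apply: dimX.2.
eexists; apply: (irreducible_chain_extend (m := 2) (Z := Z) cX irrX CT).
case: CZ => Zirr Zlt; split=> i im; first by apply: Zirr; exact: leq_trans m2.
by apply: Zlt; exact: leq_trans m2.
Qed.

(** The point below [C] gives a chain of length 1; length 2 is excluded since [C] is proper. *)
Lemma proper_irreducible_curve (C : set X) (x : X) :
    closed C -> irreducible_set C -> C `<` setT -> C x -> C <> [set x] ->
  irreducible_curve C.
Proof.
move=> cC irrC CT Cx Cnx; split=> //; split; last first.
  by move=> [Z /(proper_chain_length CT)].
exists (fun i => if i is 0%N then [set x] else C); split=> [[|i] _|[|//] _].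
- split; [exact: zariski_subspace_closed1|exact: irreducible_set1|by move=> _ ->].
- by split.
- by split=> [_ -> //|Csx]; apply: Cnx; apply/seteqP; split=> // _ ->.
Qed.

(** Otherwise the point, [C] and [A] form a chain of length 2 in the proper subset [A]. *)
Lemma curve_maximal (C A : set X) (x : X) :
    closed C -> irreducible_set C -> C x -> C <> [set x] ->
    closed A -> irreducible_set A -> A `<` setT -> C `<=` A -> A = C.
Proof.
move=> cC irrC Cx Cnx cA irrA AT CA; apply: contrapT => AnC.
suff : irreducible_chain A 2
    (fun i => match i with 0 => [set x] | 1 => C | _ => A end)%N.
  by move=> /(proper_chain_length AT).
split=> [[|[|i]] _|[|[|//]] _].
- split; [exact: zariski_subspace_closed1|exact: irreducible_set1|].
  by move=> _ ->; exact: CA.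
- by split.
- by split.
- by split=> [_ -> //|Csx]; apply: Cnx; apply/seteqP; split=> // _ ->.
- by split=> // AC; apply: AnC; apply/seteqP.
Qed.
End Surface.

(** * Orbit closures and the conclusion *)

Section Orbit.
Variables (K : fieldType) (n : nat) (X : set (projspace K n)) (f : automorphism X).

Lemma aut_orbit_fun x : f @` aut_orbit f x `<=` aut_orbit f x.
Proof.
(* The exponent -1, encoded as [Negz 0], is apart because its successor changes constructor. *)
move=> _ [_ [k _ <-] <-]; case: k => [k|[|k]].
- by exists (Posz k.+1).
- by exists (Posz 0) => //=; rewrite aut_invK.
- by exists (Negz k) => //=; rewrite aut_invK.
Qed.

Lemma aut_orbit_inv x : aut_inv f @` aut_orbit f x `<=` aut_orbit f x.
Proof.
move=> _ [_ [k _ <-] <-]; case: k => [[|k]|k].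
- by exists (Negz 0).
- by exists (Posz k) => //=; rewrite aut_funK.
- by exists (Negz k.+1).
Qed.
End Orbit.

(** The preimage of the closure is closed and contains [A]. *)
Lemma closure_image_invariant (T : topologicalType) (g : T -> T) (A : set T) :
  continuous g -> g @` A `<=` A -> g @` closure A `<=` closure A.
Proof.
move=> cg gA; rewrite image_sub.
have cpre : closed (g @^-1` closure A).
  by apply: (proj1 (continuous_closedP _) cg); exact: closed_closure.
rewrite [X in _ `<=` X](proj1 (closure_id _) cpre); apply: closure_subset => y Ay.
by apply: subset_closure; apply: gA; exists y.
Qed.

Theorem corollary3p3 (R : realType) (n : nat) (X : set (projspace R[i] n))
  (hX : smooth_projective_surface X) (f : automorphism X)
  (hf : positive_entropy f) (x : X)
  (hper : ~ periodic_point f x)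
  (hE : ~ maximal_invariant_curve f x) :
  dense (aut_orbit f x).
Proof.
case: hX => cX irrX dimX _ O [y Oy] oO; apply: contrapT => nO.
pose Z := closure (aut_orbit f x).
(* The point [y] is outside [Z], as the orbit avoids its neighbourhood [O]. *)
have ZT : Z `<` setT.
  split=> // /(_ y I) /(_ O); case; first exact: open_nbhs_nbhs.
  by move=> z [orbz Oz]; apply: nO; exists z.
have cZ : closed Z := @closed_closure _ _.
have Zx : Z x by apply: subset_closure; exists (Posz 0).
have cf := regular_map_continuous (aut_regular f).
have cg := regular_map_continuous (aut_inv_regular f).
have sub_proper A : A `<=` Z -> A `<` setT.
  by move=> AZ; split=> // TA; apply: ZT.2; exact: subset_trans AZ.
have periodic := maximal_irreducible_periodic (@zariski_noetherian _ _ X) cf cg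
  (aut_funK f) (aut_invK f) cZ (closure_image_invariant cf (@aut_orbit_fun _ _ _ f x))
  (closure_image_invariant cg (@aut_orbit_inv _ _ _ f x)).
(* Any irreducible closed [C] in [Z] through [x], other than the point, is already maximal by
   dimension, so no component has to be selected. *)
have [[C [cC irrC CZ Cx Cnx]]|nC] := pselect (exists C : set X,
  [/\ closed C, irreducible_set C, C `<=` Z, C x & C <> [set x]]).
- have [|m m0 mC] := periodic C irrC CZ.
    move=> A cA irrA AZ; apply: (curve_maximal cX irrX dimX cC irrC Cx Cnx) => //.
    exact: sub_proper.
  apply: hE; exists C => //; split; last by exists m.
  by apply: proper_irreducible_curve Cx Cnx => //; exact: sub_proper.
(* Without such a [C] the singleton is itself maximal, and its period as a set is one of [x]. *)
- have [||m m0 mx] := periodic _ (irreducible_set1 x).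
  + by move=> _ ->.
  + move=> A cA irrA AZ xA; apply: contrapT => Anx; apply: nC; exists A; split=> //.
    exact: xA.
  apply: hper; exists m => //.
  by have : (iter m f @` [set x]) (iter m f x) by [exists x]; rewrite mx.
Qed.
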